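(* Let $N$ be a positive integer and let $a,b,c,t,q\in\mathbb{C}$ with $|b|<1$ and $|q|<1$. Then \[ \sum_{n=0}^{\infty}\frac{(c/b)_n}{(q)_n} \frac{(t)_n}{(at)_n}\frac{(a tq^N)_{n}}{(tq^N)_{n}}b^n = \frac{(t)_{N}(c)_\infty}{(at)_{N}(b)_\infty}\sum_{n=0}^{\infty}\left\{\sum_{k=0}^{n}\begin{bmatrix} n\\k\end{bmatrix}\left(aq^{N}\right)^k(q^{-N})_{k}(q^{N})_{n-k}\right\}\frac{(b)_n}{(c)_n(q)_n}t^n. \]
   Context: For $x\in\mathbb{C}$ and $n\ge 0$, $(x)_n=(x;q)_n=\prod_{j=0}^{n-1}(1-xq^j)$ (with $(x)_0=1$) and $(x)_\infty=\prod_{j=0}^{\infty}(1-xq^j)$. The Gaussian binomial coefficient is $\begin{bmatrix} n\\k\end{bmatrix}=\frac{(q)_n}{(q)_{n-k}(q)_k}$ for $0\le k\le n$.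
   Formalization: The right-hand series may diverge when |t| ≥ 1, so the identity is proved whenever that series converges (shown for all |t| < 1); b and q are taken nonzero and (at)_n, (tq^N)_n, (c)_n nonzero for all n, so that every term is defined. *)

(* Defs.v *)
From Stdlib Require Import Reals.
From Coquelicot Require Import Coquelicot.

Local Open Scope C_scope.

(* Componentwise limit.  [Lim_seq] is total, so this is meaningful only for
   convergent sequences; likewise [CSeries] only for convergent series. *)
Definition CLim (u : nat -> C) : C :=
  (real (Lim_seq (fun n => Re (u n))), real (Lim_seq (fun n => Im (u n)))).

Definition CSeries (u : nat -> C) : C := CLim (sum_n u).

(* [C] carries several normed-module structures (over R and over C); this pins
   the one over C. *)
Definition ex_Cseries (u : nat -> C) : Prop :=
  @ex_series C_AbsRing C_NormedModule u.

(* (x;q)_n *)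
Fixpoint qpoch (x q : C) (n : nat) : C :=
  match n with
  | O => 1
  | S m => qpoch x q m * (1 - x * q ^ m)
  end.

(* (x;q)_oo; the product converges whenever |q| < 1. *)
Definition qpoch_inf (x q : C) : C := CLim (qpoch x q).

(* Only meaningful for k <= n, because of the truncated subtraction. *)
Definition qbinom (q : C) (n k : nat) : C :=
  qpoch q q n / (qpoch q q (n - k) * qpoch q q k).

Definition lhs_term (N : nat) (a b c t q : C) (n : nat) : C :=
  qpoch (c / b) q n / qpoch q q n
  * (qpoch t q n / qpoch (a * t) q n)
  * (qpoch (a * t * q ^ N) q n / qpoch (t * q ^ N) q n)
  * b ^ n.

Definition rhs_coef (N : nat) (a q : C) (n : nat) : C :=
  sum_n (fun k => qbinom q n k * (a * q ^ N) ^ k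
                  * qpoch (/ q ^ N) q k * qpoch (q ^ N) q (n - k)) n.

Definition rhs_term (N : nat) (a b c t q : C) (n : nat) : C :=
  rhs_coef N a q n * (qpoch b q n / (qpoch c q n * qpoch q q n)) * t ^ n.

(* Main.v *)
(** The generating function of [rhs_coef n / (q)_n] is the rational function
    f(x) = (ax)_N/(x)_N, and by the q-binomial theorem (b)_n/(c)_n is a
    combination of the geometric sequences q^(mn) with weights
    g_m = (c/b)_m b^m/(q)_m, up to the factor (b)_oo/(c)_oo.  Summing over n
    first turns the right-hand series into sum_m g_m f(t q^m), which is the
    left-hand series up to the factor (at)_N/(t)_N.

    To cover |t| >= 1 as well, f is decomposed into partial fractions
    beta_j/(1 - x q^j), j < N.  If the right-hand series converges then its
    terms tend to 0, which forces beta_j = 0 whenever |t q^j| >= 1, so that only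
    convergent geometric series remain.  In particular t = q^(-j) with j < N
    would give beta_j = 0, hence (at)_N = 0, which is excluded. *)

Require Import Defs.
From Stdlib Require Import Reals.
From Coquelicot Require Import Coquelicot.
From Stdlib Require Import Lra Lia.

Local Open Scope C_scope.

(** * Elementary facts about complex moduli, powers and zero products *)

Lemma Cmod_minus_triangle (x y : C) : (Cmod x - Cmod y <= Cmod (x - y))%R.
Proof.
  pose proof (Cmod_triangle (x - y) y) as H.
  replace (x - y + y) with x in H by ring. lra.
Qed.

Lemma Cmod_minus_sym (x y : C) : Cmod (x - y) = Cmod (y - x).
Proof. rewrite <- (Cmod_opp (y - x)). f_equal. ring. Qed.

Lemma one_minus_neq_0 (x : C) : (Cmod x < 1)%R -> 1 - x <> 0.
Proof.
  intros H E.
  assert (x = 1) as -> by (replace x with (1 - (1 - x)) by ring; rewrite E; ring).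
  rewrite Cmod_1 in H. lra.
Qed.

Lemma Cpow_comp (x : C) (m n : nat) : (x ^ m) ^ n = (x ^ n) ^ m.
Proof. rewrite <- !Cpow_mult_r. f_equal. lia. Qed.

Lemma Cmod_pow_le_1 (x : C) (n : nat) : (Cmod x <= 1)%R -> (Cmod (x ^ n) <= 1)%R.
Proof.
  intros H. rewrite Cmod_pow. rewrite <- (pow1 n). apply pow_incr.
  split; [apply Cmod_ge_0 | exact H].
Qed.

Lemma Cmult_neq_0_inv (x y : C) : x * y <> 0 -> x <> 0 /\ y <> 0.
Proof. intros H; split; intros ->; apply H; ring. Qed.

Lemma Cmult_eq_0 (x y : C) : x * y = 0 -> x = 0 \/ y = 0.
Proof.
  intros H. destruct (Ceq_dec x 0) as [|Hx]; [now left|].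
  destruct (Ceq_dec y 0) as [|Hy]; [now right|].
  exfalso. now apply (Cmult_neq_0 x y).
Qed.

Lemma Cminus_eq_0 (x y : C) : x - y = 0 -> x = y.
Proof. intros H. replace x with (x - y + y) by ring. rewrite H. ring. Qed.

(** * Finite sums, limits and series of complex numbers *)

(** The upper bound is excluded, unlike in [sum_n], so that the empty sum is available for sums over
    j < N and for inductions from 0. *)
Fixpoint csum (f : nat -> C) (n : nat) : C :=
  match n with
  | O => 0
  | S m => csum f m + f m
  end.

Lemma csum_sum_n (f : nat -> C) (n : nat) : sum_n f n = csum f (S n).
Proof.
  induction n as [|n IH].
  - rewrite sum_O. simpl. ring.
  - rewrite sum_Sn, IH. reflexivity.
Qed.

Lemma csum_ext (f g : nat -> C) (n : nat) :
  (forall j, (j < n)%nat -> f j = g j) -> csum f n = csum g n.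
Proof.
  induction n as [|n IH]; intros H; simpl; [reflexivity|].
  rewrite IH by (intros; apply H; lia). rewrite H by lia. reflexivity.
Qed.

Lemma csum_plus (f g : nat -> C) (n : nat) :
  csum (fun j => f j + g j) n = csum f n + csum g n.
Proof. induction n as [|n IH]; simpl; [ring | rewrite IH; ring]. Qed.

Lemma csum_scal (k : C) (f : nat -> C) (n : nat) :
  csum (fun j => k * f j) n = k * csum f n.
Proof. induction n as [|n IH]; simpl; [ring | rewrite IH; ring]. Qed.

Lemma csum_shift (f : nat -> C) (n : nat) :
  csum f (S n) = f O + csum (fun j => f (S j)) n.
Proof.
  induction n as [|n IH]; [simpl; ring|].
  change (csum f (S (S n))) with (csum f (S n) + f (S n)). rewrite IH. simpl. ring.
Qed.

(** Stating convergence through a real sequence of moduli makes squeeze arguments directly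
    applicable. *)
Definition clim (u : nat -> C) (l : C) : Prop :=
  is_lim_seq (fun n => Cmod (u n - l)) 0%R.

Lemma clim_ext (u v : nat -> C) (l : C) :
  (forall n, u n = v n) -> clim u l -> clim v l.
Proof.
  intros E. apply is_lim_seq_ext. intros n. now rewrite E.
Qed.

Lemma clim_0_dominated (u : nat -> C) (v : nat -> R) (l : C) :
  (forall n, (Cmod (u n - l) <= v n)%R) -> is_lim_seq v 0%R -> clim u l.
Proof.
  intros H Hv. apply is_lim_seq_le_le with (u := fun _ => 0%R) (w := v).
  - intros n. split; [apply Cmod_ge_0 | apply H].
  - apply is_lim_seq_const.
  - exact Hv.
Qed.

Lemma clim_const (k : C) : clim (fun _ => k) k.
Proof.
  apply clim_0_dominated with (v := fun _ => 0%R).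
  - intros _. replace (k - k) with (RtoC 0) by ring. rewrite Cmod_0. lra.
  - apply is_lim_seq_const.
Qed.

Lemma is_lim_seq_scal_0 (k : R) (v : nat -> R) :
  is_lim_seq v 0%R -> is_lim_seq (fun n => k * v n)%R 0%R.
Proof.
  intros H. replace (Finite 0) with (Rbar_mult k 0) by (simpl; f_equal; ring).
  now apply is_lim_seq_scal_l.
Qed.

Lemma is_lim_seq_plus_0 (u v : nat -> R) :
  is_lim_seq u 0%R -> is_lim_seq v 0%R -> is_lim_seq (fun n => u n + v n)%R 0%R.
Proof.
  intros Hu Hv. replace (Finite 0) with (Finite (0 + 0)) by (f_equal; ring).
  now apply is_lim_seq_plus'.
Qed.

Lemma clim_plus (u v : nat -> C) (l m : C) :
  clim u l -> clim v m -> clim (fun n => u n + v n) (l + m).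
Proof.
  intros Hu Hv.
  apply clim_0_dominated with (v := fun n => (Cmod (u n - l) + Cmod (v n - m))%R).
  - intros n. replace (u n + v n - (l + m)) with ((u n - l) + (v n - m)) by ring.
    apply Cmod_triangle.
  - now apply is_lim_seq_plus_0.
Qed.

Lemma clim_mult (u v : nat -> C) (l m : C) :
  clim u l -> clim v m -> clim (fun n => u n * v n) (l * m).
Proof.
  intros Hu Hv.
  apply clim_0_dominated with
    (v := fun n => (Cmod (u n - l) * Cmod (v n - m)
                    + (Cmod m * Cmod (u n - l) + Cmod l * Cmod (v n - m)))%R).
  - intros n.
    replace (u n * v n - l * m)
      with ((u n - l) * (v n - m) + (m * (u n - l) + l * (v n - m))) by ring.
    eapply Rle_trans; [apply Cmod_triangle|]. rewrite Cmod_mult.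
    apply Rplus_le_compat_l.
    eapply Rle_trans; [apply Cmod_triangle|]. rewrite !Cmod_mult. lra.
  - apply is_lim_seq_plus_0; [|apply is_lim_seq_plus_0; now apply is_lim_seq_scal_0].
    replace (Finite 0) with (Finite (0 * 0)) by (f_equal; ring).
    now apply is_lim_seq_mult'.
Qed.

Lemma clim_scal (k : C) (u : nat -> C) (l : C) :
  clim u l -> clim (fun n => k * u n) (k * l).
Proof. intros H. apply clim_mult; [apply clim_const | exact H]. Qed.

Lemma clim_Cmod (u : nat -> C) (l : C) :
  clim u l -> is_lim_seq (fun n => Cmod (u n)) (Cmod l).
Proof.
  intros H.
  apply is_lim_seq_le_le with (u := fun n => (Cmod l - Cmod (u n - l))%R)
    (w := fun n => (Cmod l + Cmod (u n - l))%R).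
  - intros n. pose proof (Cmod_minus_triangle (u n) l).
    pose proof (Cmod_minus_triangle l (u n)) as H1.
    rewrite Cmod_minus_sym in H1. lra.
  - replace (Finite (Cmod l)) with (Finite (Cmod l - 0)) by (f_equal; ring).
    apply is_lim_seq_minus'; [apply is_lim_seq_const | exact H].
  - replace (Finite (Cmod l)) with (Finite (Cmod l + 0)) by (f_equal; ring).
    apply is_lim_seq_plus'; [apply is_lim_seq_const | exact H].
Qed.

Lemma clim_Cmod_le (u : nat -> C) (l : C) (M : R) :
  (forall n, (Cmod (u n) <= M)%R) -> clim u l -> (Cmod l <= M)%R.
Proof.
  intros H Hu.
  apply (is_lim_seq_le (fun n => Cmod (u n)) (fun _ => M) (Cmod l) M H).
  - now apply clim_Cmod.
  - apply is_lim_seq_const.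
Qed.

Lemma clim_unique (u : nat -> C) (l m : C) : clim u l -> clim u m -> l = m.
Proof.
  intros Hl Hm.
  apply Cminus_eq_0, Cmod_eq_0, Rle_antisym; [|apply Cmod_ge_0].
  apply (is_lim_seq_le (fun _ => Cmod (l - m))
           (fun n => (Cmod (u n - l) + Cmod (u n - m))%R) (Cmod (l - m)) 0%R).
  - intros n. rewrite (Cmod_minus_sym (u n) l).
    replace (l - m) with ((l - u n) + (u n - m)) by ring. apply Cmod_triangle.
  - apply is_lim_seq_const.
  - now apply is_lim_seq_plus_0.
Qed.

Lemma clim_bounded (u : nat -> C) (l : C) :
  clim u l -> exists M : R, forall n, (Cmod (u n) <= M)%R.
Proof.
  intros H.
  destruct (filterlim_bounded (K := R_AbsRing) (V := R_NormedModule)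
              (fun n => Cmod (u n))) as [M HM].
  - exists (Cmod l). apply (clim_Cmod u l H).
  - exists M. intros n. eapply Rle_trans; [|apply (HM n)]. apply Rle_abs.
Qed.

Lemma clim_eventually_neq_0 (u : nat -> C) (l : C) :
  clim u l -> l <> 0 -> eventually (fun n => (Cmod l / 2 < Cmod (u n))%R).
Proof.
  intros H Hl.
  assert (0 < Cmod l / 2)%R as P by (pose proof (proj1 (Cmod_gt_0 l) Hl); lra).
  apply is_lim_seq_spec in H. destruct (H (mkposreal _ P)) as [N HN].
  exists N. intros n Hn. specialize (HN n Hn). simpl in HN.
  rewrite Rminus_0_r, Rabs_pos_eq in HN by apply Cmod_ge_0.
  pose proof (Cmod_minus_triangle l (u n)) as H1. rewrite Cmod_minus_sym in H1. lra.
Qed.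

(** Once |u n| > |l|/2, the difference of the inverses is at most 2 |u n - l| / |l|^2. This holds
    only eventually, hence the local form of the squeeze. *)
Lemma clim_inv (u : nat -> C) (l : C) :
  clim u l -> l <> 0 -> clim (fun n => / u n) (/ l).
Proof.
  intros H Hl.
  pose proof (proj1 (Cmod_gt_0 l) Hl) as P.
  apply (is_lim_seq_le_le_loc (fun _ => 0%R) _
           (fun n => (2 / (Cmod l * Cmod l) * Cmod (u n - l))%R)).
  - destruct (clim_eventually_neq_0 u l H Hl) as [N HN].
    exists N. intros n Hn. specialize (HN n Hn). split; [apply Cmod_ge_0|].
    assert (u n <> 0) as Hu by (apply Cmod_gt_0; lra).
    replace (/ u n - / l) with ((l - u n) * / (u n * l)) by (field; auto).
    rewrite Cmod_mult, Cmod_inv, Cmod_mult, (Cmod_minus_sym l) by (apply Cmult_neq_0; auto).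
    rewrite Rmult_comm. apply Rmult_le_compat_r; [apply Cmod_ge_0|].
    replace (2 / (Cmod l * Cmod l))%R with (/ (Cmod l / 2 * Cmod l))%R by (field; lra).
    apply Rinv_le_contravar; [nra|]. apply Rmult_le_compat_r; lra.
  - apply is_lim_seq_const.
  - now apply is_lim_seq_scal_0.
Qed.

Lemma clim_shift (u : nat -> C) (l : C) (k : nat) :
  clim u l <-> clim (fun n => u (n + k)%nat) l.
Proof. apply (is_lim_seq_incr_n (fun n => Cmod (u n - l)) k). Qed.

Lemma is_lim_seq_Cmod_pow (x : C) :
  (Cmod x < 1)%R -> is_lim_seq (fun n => (Cmod x ^ n)%R) 0%R.
Proof.
  intros H. apply is_lim_seq_geom. rewrite Rabs_pos_eq; [exact H | apply Cmod_ge_0].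
Qed.

Lemma clim_pow (x : C) : (Cmod x < 1)%R -> clim (fun n => x ^ n) 0.
Proof.
  intros H. apply clim_0_dominated with (v := fun n => (Cmod x ^ n)%R).
  - intros n. replace (x ^ n - 0) with (x ^ n) by ring. rewrite Cmod_pow. lra.
  - now apply is_lim_seq_Cmod_pow.
Qed.

Lemma clim_CLim (u : nat -> C) (l : C) : clim u l -> CLim u = l.
Proof.
  intros H. unfold CLim.
  (* [Re] and [Im] are treated together: all that matters is that f is compatible with subtraction
     and bounded by the modulus. *)
  assert (forall f : C -> R, (forall z, Rabs (f z) <= Cmod z)%R ->
            (forall x y : C, f (x - y)%C = f x - f y)%R ->
            Lim_seq (fun n => f (u n)) = f l) as K.
  { intros f Hf Hm. apply is_lim_seq_unique.
    apply is_lim_seq_ext with (u := fun n => (f (u n - l)%C + f l)%R).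
    - intros n. rewrite Hm. ring.
    - replace (Finite (f l)) with (Finite (0 + f l)) by (f_equal; ring).
      apply is_lim_seq_plus'; [|apply is_lim_seq_const].
      apply is_lim_seq_abs_0.
      apply is_lim_seq_le_le with (u := fun _ => 0%R) (w := fun n => Cmod (u n - l)).
      + intros n. split; [apply Rabs_pos | apply Hf].
      + apply is_lim_seq_const.
      + exact H. }
  rewrite (K Re), (K Im).
  - simpl. now destruct l.
  - intros z. eapply Rle_trans; [apply Rmax_r | apply Rmax_Cmod].
  - intros x y. reflexivity.
  - intros z. eapply Rle_trans; [apply Rmax_l | apply Rmax_Cmod].
  - intros x y. reflexivity.
Qed.

(** * Convergent series and geometric domination *)

Definition csers (u : nat -> C) (l : C) : Prop := clim (csum u) l.

(** Gives access to the comparison test for normed modules; the shift by one reconciles the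
    inclusive bound of [sum_n] with [csum]. *)
Lemma is_series_csers (u : nat -> C) (l : C) :
  @is_series C_AbsRing C_NormedModule u l <-> csers u l.
Proof.
  pose proof (filterlim_locally_ball_norm (K := C_AbsRing) (U := C_NormedModule)
                (F := eventually) (sum_n u) l) as B.
  unfold csers. rewrite (clim_shift _ _ 1). unfold clim. rewrite <- is_lim_seq_spec.
  assert (forall n, Cmod (csum u (n + 1) - l)
                    = norm (K := C_AbsRing) (V := C_NormedModule)
                        (minus (sum_n u n : C_NormedModule) l)) as E.
  { intros n. rewrite Nat.add_1_r, <- csum_sum_n. reflexivity. }
  split; intros H.
  - intros eps. destruct (proj1 B H eps) as [N HN]. exists N. intros n Hn.
    rewrite E, Rminus_0_r, Rabs_pos_eq by apply norm_ge_0. exact (HN n Hn).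
  - apply (proj2 B). intros eps. destruct (H eps) as [N HN]. exists N. intros n Hn.
    specialize (HN n Hn).
    rewrite E, Rminus_0_r, Rabs_pos_eq in HN by apply norm_ge_0. exact HN.
Qed.

Lemma ex_Cseries_csers (u : nat -> C) (l : C) : csers u l -> ex_Cseries u.
Proof. intros H. exists l. now apply is_series_csers. Qed.

Lemma csers_CSeries (u : nat -> C) (l : C) : csers u l -> CSeries u = l.
Proof.
  intros H. apply clim_CLim.
  apply clim_ext with (u := fun n => csum u (n + 1)).
  - intros n. rewrite Nat.add_1_r. symmetry. apply csum_sum_n.
  - exact (proj1 (clim_shift (csum u) l 1) H).
Qed.

Lemma csers_ext (u v : nat -> C) (l : C) :
  (forall n, u n = v n) -> csers u l -> csers v l.
Proof. intros E. apply clim_ext. intros n. apply csum_ext. intros j _. apply E. Qed.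

Lemma csers_plus (u v : nat -> C) (l m : C) :
  csers u l -> csers v m -> csers (fun n => u n + v n) (l + m).
Proof.
  intros Hu Hv. eapply clim_ext; [|exact (clim_plus _ _ _ _ Hu Hv)].
  intros n. symmetry. apply csum_plus.
Qed.

Lemma csers_scal (k : C) (u : nat -> C) (l : C) :
  csers u l -> csers (fun n => k * u n) (k * l).
Proof.
  intros Hu. eapply clim_ext; [|exact (clim_scal k _ _ Hu)].
  intros n. symmetry. apply csum_scal.
Qed.

Lemma csers_csum (u : nat -> nat -> C) (l : nat -> C) (N : nat) :
  (forall j, (j < N)%nat -> csers (u j) (l j)) ->
  csers (fun n => csum (fun j => u j n) N) (csum l N).
Proof.
  induction N as [|N IH]; intros H; simpl.
  - eapply clim_ext; [|apply clim_const].
    intros n. induction n as [|n IHn]; simpl; [reflexivity|]. rewrite <- IHn. ring.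
  - apply csers_plus; [apply IH; intros; apply H; lia | apply H; lia].
Qed.

Lemma csers_incr (u : nat -> C) (l : C) :
  csers (fun n => u (S n)) l -> csers u (u O + l).
Proof.
  intros H. apply (clim_shift _ _ 1).
  eapply clim_ext; [|exact (clim_plus _ _ _ _ (clim_const (u O)) H)].
  intros n. now rewrite Nat.add_1_r, csum_shift.
Qed.

Lemma csers_0 : csers (fun _ => 0) 0.
Proof.
  refine (clim_ext _ _ _ _ (clim_const 0)).
  intros n. induction n as [|n IH]; simpl; [reflexivity|]. rewrite <- IH. ring.
Qed.

Lemma csers_first (k : C) : csers (fun n : nat => if n then k else 0) k.
Proof.
  pose proof (csers_incr (fun n : nat => if n then k else 0) 0 csers_0) as H.
  cbn in H. now rewrite Cplus_0_r in H.
Qed.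

Lemma csers_term_0 (u : nat -> C) (l : C) : csers u l -> clim u 0.
Proof.
  intros H.
  assert (clim (fun n => csum u (n + 1) + - (1) * csum u n) (l + - (1) * l)) as H1.
  { apply (clim_plus (fun n => csum u (n + 1))); [exact (proj1 (clim_shift (csum u) l 1) H) | now apply clim_scal]. }
  replace (l + - (1) * l) with (RtoC 0) in H1 by ring.
  refine (clim_ext _ _ _ _ H1). intros n. rewrite Nat.add_1_r. simpl. ring.
Qed.

Lemma csers_geom_dominated (u : nat -> C) (M r : R) :
  (0 <= r < 1)%R -> (forall n, (Cmod (u n) <= M * r ^ n)%R) -> exists l, csers u l.
Proof.
  intros Hr H.
  destruct (@ex_series_le C_AbsRing C_CompleteNormedModule u
              (fun n => (M * r ^ n)%R)) as [l Hl].
  - exact H.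
  - apply (ex_series_scal_l (K := R_AbsRing) M (fun n => (r ^ n)%R)).
    apply ex_series_geom. rewrite Rabs_pos_eq; lra.
  - exists l. now apply is_series_csers.
Qed.

Lemma csers_geom_dominated_le (u : nat -> C) (l : C) (M r : R) :
  (0 <= r < 1)%R -> (forall n, (Cmod (u n) <= M * r ^ n)%R) -> csers u l ->
  (Cmod l <= M / (1 - r))%R.
Proof.
  intros Hr H. apply clim_Cmod_le. intros n.
  assert (0 <= M)%R as HM.
  { specialize (H O). simpl in H. pose proof (Cmod_ge_0 (u O)). lra. }
  (* The intermediate bound is the n-th partial sum of the geometric majorant. *)
  apply Rle_trans with (M / (1 - r) * (1 - r ^ n))%R.
  - induction n as [|n IH]; simpl.
    + rewrite Cmod_0. lra.
    + eapply Rle_trans; [apply Cmod_triangle|].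
      eapply Rle_trans; [apply Rplus_le_compat; [exact IH | apply H]|].
      right. field. lra.
  - rewrite <- (Rmult_1_r (M / (1 - r))) at 2. apply Rmult_le_compat_l.
    + apply Rmult_le_pos; [exact HM|]. left. apply Rinv_0_lt_compat. lra.
    + pose proof (pow_le r n (proj1 Hr)). lra.
Qed.

Lemma clim_csum (u : nat -> nat -> C) (l : nat -> C) (N : nat) :
  (forall j, (j < N)%nat -> clim (u j) (l j)) ->
  clim (fun n => csum (fun j => u j n) N) (csum l N).
Proof.
  induction N as [|N IH]; intros H; simpl; [apply clim_const|].
  apply clim_plus; [apply IH; intros; apply H; lia | apply H; lia].
Qed.

Lemma csers_CSeries_ex (u : nat -> C) : (exists l, csers u l) -> csers u (CSeries u).
Proof. intros [l H]. now rewrite (csers_CSeries u l H). Qed.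

(** * The q-Pochhammer symbol and the q-binomial theorem *)

Lemma qpoch_add (x q : C) (m n : nat) :
  qpoch x q (m + n) = qpoch x q m * qpoch (x * q ^ m) q n.
Proof.
  induction n as [|n IH].
  - rewrite Nat.add_0_r. simpl. ring.
  - rewrite Nat.add_succ_r. simpl. rewrite IH, Cpow_add_r. ring.
Qed.

Lemma qpoch_S_l (x q : C) (n : nat) :
  qpoch x q (S n) = (1 - x) * qpoch (x * q) q n.
Proof.
  change (S n) with (1 + n)%nat. rewrite qpoch_add, Cpow_1_r. simpl. ring.
Qed.

Lemma qpoch_neq_0 (x q : C) (n : nat) :
  (forall j, (j < n)%nat -> 1 - x * q ^ j <> 0) -> qpoch x q n <> 0.
Proof.
  induction n as [|n IH]; intros H; simpl; [exact C1_nz|].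
  apply Cmult_neq_0; [apply IH; intros; apply H; lia | apply H; lia].
Qed.

Lemma qpoch_neq_0_factor (x q : C) (n j : nat) :
  qpoch x q n <> 0 -> (j < n)%nat -> 1 - x * q ^ j <> 0.
Proof.
  induction n as [|n IH]; intros H Hj; [lia|].
  apply Cmult_neq_0_inv in H as [H1 H2].
  destruct (Nat.eq_dec j n) as [->|E]; [exact H2 | apply IH; [exact H1 | lia]].
Qed.

Lemma qpoch_neq_0_small (x q : C) (n : nat) :
  (Cmod x < 1)%R -> (Cmod q < 1)%R -> qpoch x q n <> 0.
Proof.
  intros Hx Hq. apply qpoch_neq_0. intros j _. apply one_minus_neq_0.
  rewrite Cmod_mult. pose proof (Cmod_pow_le_1 q j (Rlt_le _ _ Hq)).
  pose proof (Cmod_ge_0 x). pose proof (Cmod_ge_0 (q ^ j)). nra.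
Qed.

(** With r = |q|, each factor satisfies |1 - x q^j| <= 1 + |x| r^j <= exp(|x| r^j), and the
    exponents form a geometric sum. *)
Lemma qpoch_bounded (x q : C) :
  (Cmod q < 1)%R -> exists M : R, forall n, (Cmod (qpoch x q n) <= M)%R.
Proof.
  intros Hq. pose proof (Cmod_ge_0 q) as Hq0. pose proof (Cmod_ge_0 x) as Hx.
  set (r := Cmod q) in *.
  exists (exp (Cmod x / (1 - r))). intros n.
  assert (Cmod (qpoch x q n) <= exp (Cmod x / (1 - r) * (1 - r ^ n)))%R as H.
  { induction n as [|n IH].
    - simpl. rewrite Cmod_1, Rminus_diag, Rmult_0_r, exp_0. lra.
    - replace (Cmod x / (1 - r) * (1 - r ^ S n))%R
        with (Cmod x / (1 - r) * (1 - r ^ n) + Cmod x * r ^ n)%R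
        by (simpl; field; lra).
      rewrite exp_plus. simpl. rewrite Cmod_mult.
      apply Rmult_le_compat; [apply Cmod_ge_0 | apply Cmod_ge_0 | exact IH |].
      eapply Rle_trans; [|apply exp_ineq1_le].
      eapply Rle_trans; [apply Cmod_triangle|].
      rewrite Cmod_1, Cmod_opp, Cmod_mult, Cmod_pow. fold r. lra. }
  eapply Rle_trans; [exact H|].
  destruct (Req_dec (Cmod x / (1 - r) * (1 - r ^ n)) (Cmod x / (1 - r))) as [->|E]; [lra|].
  left. apply exp_increasing.
  assert (0 <= Cmod x / (1 - r))%R.
  { apply Rmult_le_pos; [exact Hx|]. left. apply Rinv_0_lt_compat. lra. }
  pose proof (pow_le r n Hq0). nra.
Qed.

(** Consecutive products differ by -x q^n (x)_n, which is geometrically dominated because (x)_n is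
    bounded; the sequence is thus the partial sums of a convergent series. *)
Lemma qpoch_cvg (x q : C) :
  (Cmod q < 1)%R -> exists l, clim (qpoch x q) l.
Proof.
  intros Hq. destruct (qpoch_bounded x q Hq) as [M HM].
  destruct (csers_geom_dominated (fun n => - x * q ^ n * qpoch x q n)
              (Cmod x * M) (Cmod q)) as [l Hl].
  - split; [apply Cmod_ge_0 | exact Hq].
  - intros n. rewrite !Cmod_mult, Cmod_opp, Cmod_pow.
    specialize (HM n). pose proof (Cmod_ge_0 x).
    pose proof (pow_le (Cmod q) n (Cmod_ge_0 q)).
    assert (0 <= Cmod x * Cmod q ^ n)%R by nra. nra.
  - exists (1 + l).
    refine (clim_ext _ _ _ _ (clim_plus _ _ _ _ (clim_const 1) Hl)).
    intros n. induction n as [|n IH]; simpl; [ring|]. rewrite <- IH. ring.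
Qed.

Lemma qpoch_clim_inf (x q : C) :
  (Cmod q < 1)%R -> clim (qpoch x q) (qpoch_inf x q).
Proof.
  intros Hq. destruct (qpoch_cvg x q Hq) as [l Hl].
  unfold qpoch_inf. now rewrite (clim_CLim _ _ Hl).
Qed.

Lemma qpoch_inf_split (x q : C) (k : nat) :
  (Cmod q < 1)%R -> qpoch_inf x q = qpoch x q k * qpoch_inf (x * q ^ k) q.
Proof.
  intros Hq. apply (clim_unique (fun n => qpoch x q (n + k))).
  - exact (proj1 (clim_shift (qpoch x q) _ k) (qpoch_clim_inf x q Hq)).
  - refine (clim_ext _ _ _ _
              (clim_scal (qpoch x q k) _ _ (qpoch_clim_inf (x * q ^ k) q Hq))).
    intros n. rewrite Nat.add_comm. symmetry. apply qpoch_add.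
Qed.

(** Weierstrass inequality: a product of factors 1 - u_j is at least 1 minus the sum of the u_j,
    here with u_j = |y| |q|^j. The smallness of y keeps all u_j in [0, 1]. *)
Lemma qpoch_lower_bound (y q : C) (n : nat) :
  (Cmod q < 1)%R -> (Cmod y <= 1 - Cmod q)%R ->
  (1 - Cmod y / (1 - Cmod q) * (1 - Cmod q ^ n) <= Cmod (qpoch y q n))%R.
Proof.
  intros Hq Hy. pose proof (Cmod_ge_0 q) as Hq0. pose proof (Cmod_ge_0 y) as Hy0.
  set (r := Cmod q) in *.
  induction n as [|n IH].
  - simpl. rewrite Cmod_1. lra.
  - simpl. rewrite Cmod_mult.
    assert (1 - Cmod y * r ^ n <= Cmod (1 - y * q ^ n))%R as H1.
    { pose proof (Cmod_minus_triangle 1 (y * q ^ n)) as H.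
      rewrite Cmod_1, Cmod_mult, Cmod_pow in H. exact H. }
    pose proof (pow_le r n Hq0) as P.
    assert (r ^ n <= 1)%R as P1.
    { rewrite <- (pow1 n). apply pow_incr. lra. }
    set (s := (Cmod y / (1 - r))%R) in *.
    assert (0 <= s)%R.
    { apply Rmult_le_pos; [exact Hy0|]. left. apply Rinv_0_lt_compat. lra. }
    replace (Cmod y) with (s * (1 - r))%R in * by (unfold s; field; lra).
    pose proof (Cmod_ge_0 (qpoch y q n)).
    assert (s * (1 - r) * r ^ n <= 1)%R by nra.
    (* Expanded, this product exceeds the target 1 - s (1 - r^(n+1)) by the product of the two
       subtracted quantities, which is nonnegative. *)
    apply Rle_trans with ((1 - s * (1 - r ^ n)) * (1 - s * (1 - r) * r ^ n))%R.
    + assert (0 <= (s * (1 - r ^ n)) * (s * (1 - r) * r ^ n))%R.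
      { apply Rmult_le_pos; [nra|]. apply Rmult_le_pos; nra. }
      nra.
    + apply Rle_trans with (Cmod (qpoch y q n) * (1 - s * (1 - r) * r ^ n))%R.
      * apply Rmult_le_compat_r; lra.
      * apply Rmult_le_compat_l; lra.
Qed.

(** Finitely many nonzero factors are split off until |x q^k| < (1 - |q|)/2; the Weierstrass bound
    then keeps the remaining product at modulus at least 1/2. *)
Lemma qpoch_inf_neq_0 (x q : C) :
  (Cmod q < 1)%R -> (forall n, qpoch x q n <> 0) -> qpoch_inf x q <> 0.
Proof.
  intros Hq Hx.
  assert (clim (fun n => x * q ^ n) 0) as Ht.
  { replace (RtoC 0) with (x * 0) by ring. now apply clim_scal, clim_pow. }
  assert (0 < (1 - Cmod q) / 2)%R as P by lra.
  apply is_lim_seq_spec in Ht. destruct (Ht (mkposreal _ P)) as [k Hk].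
  specialize (Hk k (Nat.le_refl k)). simpl in Hk.
  rewrite Rminus_0_r, Rabs_pos_eq in Hk by apply Cmod_ge_0.
  replace (x * q ^ k - 0) with (x * q ^ k) in Hk by ring.
  rewrite (qpoch_inf_split x q k Hq). apply Cmult_neq_0; [apply Hx|].
  apply Cmod_gt_0. apply Rlt_le_trans with (1 / 2)%R; [lra|].
  apply (is_lim_seq_le (fun _ => (1 / 2)%R) (fun n => Cmod (qpoch (x * q ^ k) q n))
           (1 / 2)%R (Cmod (qpoch_inf (x * q ^ k) q))).
  - intros n. eapply Rle_trans; [|apply qpoch_lower_bound; [exact Hq | lra]].
    set (y := Cmod (x * q ^ k)) in *. pose proof (Cmod_ge_0 (x * q ^ k)) as Hy0. fold y in Hy0.
    assert (y / (1 - Cmod q) <= 1 / 2)%R.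
    { apply Rmult_le_reg_r with (1 - Cmod q)%R; [lra|]. unfold Rdiv at 1.
      rewrite Rmult_assoc, Rinv_l by lra. lra. }
    assert (0 <= y / (1 - Cmod q))%R.
    { apply Rmult_le_pos; [exact Hy0|]. left. apply Rinv_0_lt_compat. lra. }
    pose proof (pow_le (Cmod q) n (Cmod_ge_0 q)). nra.
  - apply is_lim_seq_const.
  - now apply clim_Cmod, qpoch_clim_inf.
Qed.

(** The infinite product is nonzero, so the inverses converge and are therefore bounded. *)
Lemma qpoch_inv_bounded (x q : C) :
  (Cmod q < 1)%R -> (forall n, qpoch x q n <> 0) ->
  exists M : R, forall n, (Cmod (/ qpoch x q n) <= M)%R.
Proof.
  intros Hq Hx. apply (clim_bounded _ (/ qpoch_inf x q)).
  apply clim_inv; [now apply qpoch_clim_inf | now apply qpoch_inf_neq_0].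
Qed.

(** * Power series with bounded coefficients and the q-binomial theorem *)

Lemma bounded_mult (u v : nat -> C) :
  (exists M : R, forall n, (Cmod (u n) <= M)%R) ->
  (exists M : R, forall n, (Cmod (v n) <= M)%R) ->
  exists M : R, forall n, (Cmod (u n * v n) <= M)%R.
Proof.
  intros [M HM] [K HK]. exists (M * K)%R. intros n. rewrite Cmod_mult.
  apply Rmult_le_compat; [apply Cmod_ge_0 | apply Cmod_ge_0 | apply HM | apply HK].
Qed.

Lemma csers_bounded_pow (u : nat -> C) (z : C) :
  (Cmod z < 1)%R -> (exists M : R, forall n, (Cmod (u n) <= M)%R) ->
  exists l, csers (fun n => u n * z ^ n) l.
Proof.
  intros Hz [M HM]. apply (csers_geom_dominated _ M (Cmod z)).
  - split; [apply Cmod_ge_0 | exact Hz].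
  - intros n. rewrite Cmod_mult, Cmod_pow.
    apply Rmult_le_compat_r; [apply pow_le, Cmod_ge_0 | apply HM].
Qed.

(** By the q-binomial theorem, the coefficient of z^m in (Az)_oo/(z)_oo. *)
Definition qbin_coef (A q : C) (m : nat) : C := qpoch A q m / qpoch q q m.

Lemma qbin_coef_bounded (A q : C) :
  (Cmod q < 1)%R -> exists M : R, forall n, (Cmod (qbin_coef A q n) <= M)%R.
Proof.
  intros Hq. apply bounded_mult; [now apply qpoch_bounded|].
  apply qpoch_inv_bounded; [exact Hq|]. intros n. now apply qpoch_neq_0_small.
Qed.

Lemma qbin_coef_rec (A q : C) (m : nat) : (Cmod q < 1)%R ->
  qbin_coef A q (S m) * (1 - q ^ S m) = qbin_coef A q m * (1 - A * q ^ m).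
Proof.
  intros Hq. pose proof (qpoch_neq_0_small q q (S m) Hq Hq) as H.
  unfold qbin_coef. simpl in *. apply Cmult_neq_0_inv in H as [H1 H2].
  field. split; assumption.
Qed.

(* The telescoping sum expresses that both sides have the same coefficients. *)
Lemma qbinomial_functional_eq (A q y F F' : C) :
  (Cmod q < 1)%R -> (Cmod y < 1)%R ->
  csers (fun m => qbin_coef A q m * y ^ m) F ->
  csers (fun m => qbin_coef A q m * (y * q) ^ m) F' ->
  (1 - y) * F = (1 - A * y) * F'.
Proof.
  intros Hq Hy HF HF'.
  set (v := fun m => qbin_coef A q m * y ^ m) in HF.
  assert (csers (fun m => (1 - y) * v m + - (1 - A * y) * (qbin_coef A q m * (y * q) ^ m))
            ((1 - y) * F + - (1 - A * y) * F')) as H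
    by (apply csers_plus; now apply csers_scal).
  (* The n-th partial sum of the combined series telescopes to -v_n (1 - q^n), which tends to 0
     because the terms of a convergent series do. *)
  assert (clim (fun n => - (1) * (v n * (1 + - (1) * q ^ n))) (- (1) * (0 * (1 + - (1) * 0)))) as H0.
  { apply clim_scal, clim_mult; [exact (csers_term_0 _ _ HF)|].
    apply clim_plus; [apply clim_const | now apply clim_scal, clim_pow]. }
  apply Cminus_eq_0.
  replace ((1 - y) * F - (1 - A * y) * F') with ((1 - y) * F + - (1 - A * y) * F') by ring.
  replace (RtoC 0) with (- (1) * (0 * (1 + - (1) * 0))) by ring.
  refine (clim_unique _ _ _ H (clim_ext _ _ _ _ H0)).
  intros n. induction n as [|n IH].
  - simpl. ring.
  - change (csum ?f (S n)) with (csum f n + f n). cbv beta. rewrite <- IH. unfold v.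
    replace (qbin_coef A q (S n) * y ^ S n * (1 + - (1) * q ^ S n))
      with (qbin_coef A q (S n) * (1 - q ^ S n) * y ^ S n) by ring.
    rewrite qbin_coef_rec by exact Hq. rewrite Cpow_mult_l, Cpow_S. ring.
Qed.

(** Writing F(y) for the sum at y, this is the relation (1 - y) F(y) = (1 - A y) F(yq) applied
    successively at y = z, zq, ..., z q^(n-1). *)
Lemma qbinomial_iterate (A q z F : C) (n : nat) :
  (Cmod q < 1)%R -> (Cmod z < 1)%R ->
  csers (fun m => qbin_coef A q m * z ^ m) F ->
  exists F', csers (fun m => qbin_coef A q m * (z * q ^ n) ^ m) F' /\
    qpoch z q n * F = qpoch (A * z) q n * F'.
Proof.
  intros Hq Hz HF. induction n as [|n [G [HG E]]].
  - exists F. split; [|simpl; ring].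
    refine (csers_ext _ _ _ _ HF). intros m. simpl. now rewrite Cmult_1_r.
  - assert (Cmod (z * q ^ n) < 1)%R as Hy.
    { rewrite Cmod_mult. pose proof (Cmod_pow_le_1 q n (Rlt_le _ _ Hq)).
      pose proof (Cmod_ge_0 z). pose proof (Cmod_ge_0 (q ^ n)). nra. }
    assert (Cmod (z * q ^ n * q) < 1)%R as Hy'.
    { rewrite Cmod_mult. pose proof (Cmod_ge_0 (z * q ^ n)). pose proof (Cmod_ge_0 q). nra. }
    destruct (csers_bounded_pow _ _ Hy' (qbin_coef_bounded A q Hq)) as [G' HG'].
    exists G'. split.
    + refine (csers_ext _ _ _ _ HG'). intros m.
      replace (z * q ^ n * q) with (z * q ^ S n) by (simpl; ring). reflexivity.
    + simpl. pose proof (qbinomial_functional_eq A q _ G G' Hq Hy HG HG') as E'.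
      transitivity ((1 - z * q ^ n) * (qpoch z q n * F)); [ring|]. rewrite E.
      transitivity (qpoch (A * z) q n * ((1 - z * q ^ n) * G)); [ring|]. rewrite E'. ring.
Qed.

(** Let n tend to infinity in [qbinomial_iterate]: the sum at z q^n tends to its constant term 1,
    with an error of order |q|^n. *)
Lemma qbinomial_theorem (A q z F : C) :
  (Cmod q < 1)%R -> (Cmod z < 1)%R ->
  csers (fun m => qbin_coef A q m * z ^ m) F ->
  qpoch_inf z q * F = qpoch_inf (A * z) q.
Proof.
  intros Hq Hz HF.
  destruct (qbin_coef_bounded A q Hq) as [M HM].
  destruct (qpoch_bounded (A * z) q Hq) as [K HK].
  assert (clim (fun n => F * qpoch z q n + - (1) * qpoch (A * z) q n)
            (F * qpoch_inf z q + - (1) * qpoch_inf (A * z) q)) as H1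
    by (apply clim_plus; apply clim_scal; now apply qpoch_clim_inf).
  assert (clim (fun n => F * qpoch z q n + - (1) * qpoch (A * z) q n) 0) as H2.
  { apply clim_0_dominated with
      (v := fun n => (K * (M / (1 - Cmod z)) * Cmod q ^ n)%R).
    2: { apply is_lim_seq_scal_0. now apply is_lim_seq_Cmod_pow. }
    intros n. destruct (qbinomial_iterate A q z F n Hq Hz HF) as [G [HG E]].
    replace (F * qpoch z q n + - (1) * qpoch (A * z) q n - 0)
      with (qpoch z q n * F - qpoch (A * z) q n) by ring.
    rewrite E. replace (qpoch (A * z) q n * G - qpoch (A * z) q n)
      with (qpoch (A * z) q n * (G - 1)) by ring.
    rewrite Cmod_mult, Rmult_assoc.
    apply Rmult_le_compat; [apply Cmod_ge_0 | apply Cmod_ge_0 | apply HK |].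
    (* The constant term 1 is removed; every remaining term has m >= 1, so (q^n)^m supplies at least
       one factor |q|^n. *)
    assert (csers (fun m => qbin_coef A q m * (z * q ^ n) ^ m + (if m then - (1) else 0))
              (G + - (1))) as HG1.
    { apply csers_plus; [exact HG | apply csers_first]. }
    replace (M / (1 - Cmod z) * Cmod q ^ n)%R
      with (M * Cmod q ^ n / (1 - Cmod z))%R by (field; lra).
    apply (csers_geom_dominated_le _ (G - 1) (M * Cmod q ^ n) (Cmod z)) in HG1; [exact HG1 | |].
    - split; [apply Cmod_ge_0 | exact Hz].
    - pose proof (pow_le (Cmod q) n (Cmod_ge_0 q)) as Pq.
      assert (0 <= M)%R as PM.
      { eapply Rle_trans; [apply Cmod_ge_0 | apply (HM O)]. }
      intros [|m].
      + simpl. replace (qbin_coef A q 0 * 1 + - (1)) with (RtoC 0).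
        * rewrite Cmod_0. nra.
        * unfold qbin_coef. simpl. field.
      + replace (qbin_coef A q (S m) * (z * q ^ n) ^ S m + 0)
          with (qbin_coef A q (S m) * (q ^ n * (q ^ n) ^ m) * z ^ S m)
          by (rewrite Cpow_mult_l, (Cpow_S (q ^ n)); ring).
        rewrite !Cmod_mult, (Cmod_pow z).
        apply Rmult_le_compat_r; [apply pow_le, Cmod_ge_0|].
        apply Rmult_le_compat; [apply Cmod_ge_0 | | apply HM |].
        * apply Rmult_le_pos; apply Cmod_ge_0.
        * rewrite <- (Cmod_pow q n). rewrite <- Rmult_1_r.
          apply Rmult_le_compat_l; [apply Cmod_ge_0|].
          apply Cmod_pow_le_1, Cmod_pow_le_1. lra. }
  pose proof (clim_unique _ _ _ H1 H2) as E.
  apply Cminus_eq_0. rewrite <- E. ring.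
Qed.

(* The q-binomial theorem at z = b q^n, with A = c/b. *)
Lemma qpoch_ratio_expansion (b c q : C) (n : nat) :
  (Cmod b < 1)%R -> (Cmod q < 1)%R -> b <> 0 -> (forall k, qpoch c q k <> 0) ->
  csers (fun m => qbin_coef (c / b) q m * b ^ m * (q ^ n) ^ m)
    (qpoch b q n / qpoch c q n * (qpoch_inf c q / qpoch_inf b q)).
Proof.
  intros Hb Hq Hb0 Hc.
  assert (Cmod (b * q ^ n) < 1)%R as Hy.
  { rewrite Cmod_mult. pose proof (Cmod_pow_le_1 q n (Rlt_le _ _ Hq)).
    pose proof (Cmod_ge_0 b). pose proof (Cmod_ge_0 (q ^ n)). nra. }
  destruct (csers_bounded_pow _ _ Hy (qbin_coef_bounded (c / b) q Hq)) as [G HG].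
  pose proof (qbinomial_theorem _ _ _ _ Hq Hy HG) as E.
  replace (c / b * (b * q ^ n)) with (c * q ^ n) in E by (field; exact Hb0).
  assert (forall k, qpoch b q k <> 0) as Hbn by (intros; now apply qpoch_neq_0_small).
  pose proof (qpoch_inf_neq_0 b q Hq Hbn) as Hbi.
  pose proof (qpoch_inf_split b q n Hq) as Eb.
  pose proof (qpoch_inf_split c q n Hq) as Ec. rewrite <- E in Ec.
  rewrite Eb in Hbi. apply Cmult_neq_0_inv in Hbi as [Hb1 Hb2].
  replace (qpoch b q n / qpoch c q n * (qpoch_inf c q / qpoch_inf b q)) with G.
  - refine (csers_ext _ _ _ _ HG). intros m. rewrite Cpow_mult_l. ring.
  - rewrite Eb, Ec. field. repeat split; auto.
Qed.

(** * Power series with coefficients (b)_n/(c)_n, and exponential sums tending to 0 *)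

Lemma csum_geom (x : C) (n : nat) : (1 - x) * csum (Cpow x) n = 1 - x ^ n.
Proof. induction n as [|n IH]; simpl; [ring|]. rewrite Cmult_plus_distr_l, IH. ring. Qed.

(* No interchange of two infinite sums is needed: adding the expansions of the
   first L terms gives the right-hand series up to an error O(|y|^L). *)
Lemma qpoch_ratio_series (b c q y G : C) :
  (Cmod b < 1)%R -> (Cmod q < 1)%R -> b <> 0 -> (forall k, qpoch c q k <> 0) ->
  (Cmod y < 1)%R ->
  csers (fun m => qbin_coef (c / b) q m * b ^ m / (1 - y * q ^ m)) G ->
  csers (fun n => qpoch b q n / qpoch c q n * y ^ n)
    (qpoch_inf b q / qpoch_inf c q * G).
Proof.
  intros Hb Hq Hb0 Hc Hy HG.
  assert (forall k, qpoch b q k <> 0) as Hbn by (intros; now apply qpoch_neq_0_small).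
  pose proof (qpoch_inf_neq_0 b q Hq Hbn) as Hbi.
  pose proof (qpoch_inf_neq_0 c q Hq Hc) as Hci.
  destruct (qbin_coef_bounded (c / b) q Hq) as [M HM].
  set (g := fun m => qbin_coef (c / b) q m * b ^ m) in *.
  set (w := fun n => qpoch b q n / qpoch c q n * y ^ n).
  assert (forall m, (Cmod (y * q ^ m) <= Cmod y)%R) as Hym.
  { intros m. rewrite Cmod_mult. pose proof (Cmod_pow_le_1 q m (Rlt_le _ _ Hq)).
    pose proof (Cmod_ge_0 y). pose proof (Cmod_ge_0 (q ^ m)). nra. }
  (* Remainder of the geometric series with ratio x = y q^m: 1/(1 - x) minus its first L terms is
     x^L/(1 - x). *)
  assert (forall L, csers (fun m => g m / (1 - y * q ^ m) * (y * q ^ m) ^ L)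
                      (G - qpoch_inf c q / qpoch_inf b q * csum w L)) as H1.
  { intros L.
    assert (csers (fun m => csum (fun n => y ^ n * (g m * (q ^ n) ^ m)) L)
              (csum (fun n => y ^ n * (qpoch b q n / qpoch c q n
                                 * (qpoch_inf c q / qpoch_inf b q))) L)) as H.
    { apply (csers_csum (fun n m => y ^ n * (g m * (q ^ n) ^ m))).
      intros n _. apply csers_scal. now apply qpoch_ratio_expansion. }
    rewrite (csum_ext _ (fun n => qpoch_inf c q / qpoch_inf b q * w n)) in H
      by (intros; unfold w; ring).
    rewrite csum_scal in H.
    replace (G - qpoch_inf c q / qpoch_inf b q * csum w L)
      with (G + - (1) * (qpoch_inf c q / qpoch_inf b q * csum w L)) by ring.
    refine (csers_ext _ _ _ _ (csers_plus _ _ _ _ HG (csers_scal (- (1)) _ _ H))).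
    intros m. cbv beta.
    rewrite (csum_ext _ (fun n => g m * (y * q ^ m) ^ n))
      by (intros; rewrite Cpow_mult_l, (Cpow_comp q m); ring).
    rewrite csum_scal.
    assert (1 - y * q ^ m <> 0) as Hnz
      by (apply one_minus_neq_0; specialize (Hym m); lra).
    pose proof (csum_geom (y * q ^ m) L) as EL.
    replace ((y * q ^ m) ^ L) with (1 - (1 - y * q ^ m) * csum (Cpow (y * q ^ m)) L)
      by (rewrite EL; ring).
    change (qbin_coef (c / b) q m * b ^ m) with (g m). field. exact Hnz. }
  assert (clim (fun L => G - qpoch_inf c q / qpoch_inf b q * csum w L) 0) as H2.
  { apply clim_0_dominated with
      (v := fun L => (M * / (1 - Cmod y) / (1 - Cmod b) * Cmod y ^ L)%R).
    2: { apply is_lim_seq_scal_0. now apply is_lim_seq_Cmod_pow. }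
    intros L. replace (G - qpoch_inf c q / qpoch_inf b q * csum w L - 0)
      with (G - qpoch_inf c q / qpoch_inf b q * csum w L) by ring.
    replace (M * / (1 - Cmod y) / (1 - Cmod b) * Cmod y ^ L)%R
      with (M * / (1 - Cmod y) * Cmod y ^ L / (1 - Cmod b))%R by (field; lra).
    apply (csers_geom_dominated_le _ _ _ (Cmod b)) with (3 := H1 L).
    - split; [apply Cmod_ge_0 | exact Hb].
    - intros m. unfold g.
      assert (1 - y * q ^ m <> 0) as Hnz
        by (apply one_minus_neq_0; specialize (Hym m); lra).
      pose proof (Cmod_minus_triangle 1 (y * q ^ m)) as Ht. rewrite Cmod_1 in Ht.
      specialize (Hym m).
      replace (qbin_coef (c / b) q m * b ^ m / (1 - y * q ^ m) * (y * q ^ m) ^ L)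
        with (qbin_coef (c / b) q m * / (1 - y * q ^ m) * (y * q ^ m) ^ L * b ^ m)
        by (field; exact Hnz).
      rewrite (Cmod_mult _ (b ^ m)), Cmod_pow.
      apply Rmult_le_compat_r; [apply pow_le, Cmod_ge_0|].
      rewrite Cmod_mult, (Cmod_mult (qbin_coef _ _ _)), Cmod_inv, Cmod_pow by exact Hnz.
      assert (0 <= / Cmod (1 - y * q ^ m))%R
        by (left; apply Rinv_0_lt_compat, Cmod_gt_0; exact Hnz).
      apply Rmult_le_compat.
      + apply Rmult_le_pos; [apply Cmod_ge_0 | assumption].
      + apply pow_le, Cmod_ge_0.
      + apply Rmult_le_compat; [apply Cmod_ge_0 | assumption | apply HM |].
        apply Rinv_le_contravar; lra.
      + apply pow_incr. split; [apply Cmod_ge_0 | exact Hym]. }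
  pose proof (clim_plus _ _ _ _ (clim_const (qpoch_inf b q / qpoch_inf c q * G))
                (clim_scal (- (qpoch_inf b q / qpoch_inf c q)) _ _ H2)) as H3.
  replace (qpoch_inf b q / qpoch_inf c q * G + - (qpoch_inf b q / qpoch_inf c q) * 0)
    with (qpoch_inf b q / qpoch_inf c q * G) in H3 by ring.
  refine (clim_ext _ _ _ _ H3). intros L. fold w. field. split; assumption.
Qed.

(** The bases t q^j have decreasing moduli. If some |t q^j| >= 1 then |t| >= 1, and dividing by t^n
    isolates beta_0, which must vanish; what remains has the same form with t q for t. *)
Lemma csum_pow_clim_0 (q : C) (N : nat) : (Cmod q < 1)%R -> q <> 0 ->
  forall (beta : nat -> C) (t : C),
  clim (fun n => csum (fun j => beta j * (t * q ^ j) ^ n) N) 0 ->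
  forall j, (j < N)%nat -> (1 <= Cmod (t * q ^ j))%R -> beta j = 0.
Proof.
  intros Hq Hq0. induction N as [|N IH]; intros beta t H j Hj Hm; [lia|].
  assert (1 <= Cmod t)%R as Ht.
  { rewrite Cmod_mult in Hm. pose proof (Cmod_pow_le_1 q j (Rlt_le _ _ Hq)).
    pose proof (Cmod_ge_0 t). pose proof (Cmod_ge_0 (q ^ j)). nra. }
  assert (t <> 0) as Ht0 by (apply Cmod_gt_0; lra).
  assert (beta O = 0) as E0.
  { apply (clim_unique (fun n => / t ^ n * csum (fun j => beta j * (t * q ^ j) ^ n) (S N))).
    - replace (beta O) with (beta O + csum (fun _ => 0) N).
      2: { clear. induction N as [|N IH]; simpl; [ring|]. rewrite <- IH at 2. ring. }
      refine (clim_ext _ _ _ _ (clim_plus _ _ _ _ (clim_const (beta O))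
        (clim_csum (fun j n => beta (S j) * (q ^ S j) ^ n) (fun _ => 0) N _))).
      + intros n. rewrite csum_shift, Cmult_plus_distr_l, <- csum_scal.
        pose proof (Cpow_nz t n Ht0). f_equal.
        * simpl. rewrite Cmult_1_r. field. assumption.
        * apply csum_ext. intros i _. rewrite !Cpow_mult_l. field. assumption.
      + intros i _. replace (RtoC 0) with (beta (S i) * 0) by ring.
        apply clim_scal, clim_pow. rewrite Cpow_S, Cmod_mult.
        pose proof (Cmod_pow_le_1 q i (Rlt_le _ _ Hq)).
        pose proof (Cmod_ge_0 q). pose proof (Cmod_ge_0 (q ^ i)). nra.
    - refine (clim_0_dominated _ _ _ _ H). intros n.
      set (s := csum _ (S N)).
      replace (/ t ^ n * s - 0) with (/ t ^ n * s) by ring.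
      replace (s - 0) with s by ring.
      rewrite Cmod_mult, Cmod_inv, Cmod_pow by now apply Cpow_nz.
      pose proof (pow_R1_Rle (Cmod t) n Ht) as P.
      assert (/ Cmod t ^ n <= 1)%R by (rewrite <- Rinv_1; apply Rinv_le_contravar; lra).
      pose proof (Cmod_ge_0 s). nra. }
  destruct j as [|j]; [exact E0|].
  apply (IH (fun j => beta (S j)) (t * q)); [|lia|].
  - refine (clim_ext _ _ _ _ H). intros n. rewrite csum_shift, E0.
    rewrite Cmult_0_l, Cplus_0_l. apply csum_ext. intros i _.
    now rewrite Cpow_S, Cmult_assoc.
  - now rewrite <- Cmult_assoc, <- Cpow_S.
Qed.

(** * Partial fractions of (ax)_N/(x)_N *)

(** Cauchy product of coefficient sequences; k <= n throughout, so the natural subtraction is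
    exact. *)
Definition conv (p h : nat -> C) (n : nat) : C :=
  csum (fun k => p k * h (n - k)%nat) (S n).

(* In generating functions: p' = (1 - alpha x) p and (1 - gamma x) h' = h imply
   (1 - gamma x) (p' h') = (1 - alpha x) (p h). *)
Lemma conv_rec (p p' h h' : nat -> C) (alpha gamma : C) (n : nat) :
  p' O = p O -> (forall k, p' (S k) = p (S k) - alpha * p k) ->
  h' O = h O -> (forall m, h' (S m) = gamma * h' m + h (S m)) ->
  conv p' h' (S n) - gamma * conv p' h' n = conv p h (S n) - alpha * conv p h n.
Proof.
  intros Hp0 Hp Hh0 Hh.
  (* The factor 1 - gamma x is absorbed first, turning h' into h; then p' is expanded through p. *)
  transitivity (conv p' h (S n)).
  - unfold conv at 1 3.
    change (csum ?f (S (S n))) with (csum f (S n) + f (S n)). cbv beta.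
    rewrite Nat.sub_diag, Hh0.
    rewrite (csum_ext _ (fun k => gamma * (p' k * h' (n - k)%nat) + p' k * h (S n - k)%nat)).
    + rewrite csum_plus, csum_scal. fold (conv p' h' n). ring.
    + intros k Hk. replace (S n - k)%nat with (S (n - k)) by lia. rewrite Hh. ring.
  - unfold conv. rewrite !(csum_shift _ (S n)). rewrite Hp0.
    rewrite (csum_ext (fun j => p' (S j) * h (S n - S j)%nat)
               (fun k => p (S k) * h (S n - S k)%nat + - alpha * (p k * h (n - k)%nat))).
    + rewrite csum_plus, csum_scal. ring.
    + intros k _. rewrite Hp. simpl. ring.
Qed.

(* The coefficient of x^n in (ax)_N/(x)_N. *)
Definition pf_coef (N : nat) (a q : C) : nat -> C :=
  conv (fun k => qbin_coef (/ q ^ N) q k * (a * q ^ N) ^ k) (qbin_coef (q ^ N) q).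

(** Dividing by (q)_n cancels the numerator of the Gaussian binomial and leaves a Cauchy product. *)
Lemma rhs_coef_pf_coef (N : nat) (a q : C) (n : nat) : (Cmod q < 1)%R ->
  rhs_coef N a q n / qpoch q q n = pf_coef N a q n.
Proof.
  intros Hq. unfold rhs_coef, pf_coef, conv, qbin_coef, qbinom.
  rewrite csum_sum_n. unfold Cdiv at 1. rewrite Cmult_comm, <- csum_scal.
  apply csum_ext. intros k _. field.
  repeat split; now apply qpoch_neq_0_small.
Qed.

Lemma pf_coef_O (N : nat) (a q : C) : pf_coef N a q O = 1.
Proof. unfold pf_coef, conv, qbin_coef. simpl. field. Qed.

Lemma qpoch_1_S (q : C) (n : nat) : qpoch 1 q (S n) = 0.
Proof. rewrite qpoch_S_l. ring. Qed.

(** For N = 0 both factors of the convolution involve (1)_k, which vanishes for k >= 1, and each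
    term at total degree [S n] contains a positive index. *)
Lemma pf_coef_0_S (a q : C) (n : nat) : pf_coef 0 a q (S n) = 0.
Proof.
  unfold pf_coef, conv. rewrite csum_shift. unfold qbin_coef. simpl Nat.sub.
  rewrite (csum_ext _ (fun _ => 0 * 0)).
  - rewrite csum_scal. simpl (q ^ 0). rewrite qpoch_1_S. unfold Cdiv. ring.
  - intros k _. simpl (q ^ 0). replace (/ 1) with (RtoC 1) by field.
    rewrite qpoch_1_S. unfold Cdiv. ring.
Qed.

(** The convolved sequences are the coefficients of (ax)_N and 1/(x)_N; passing to N + 1 multiplies
    the first by 1 - a q^N x and divides the second by 1 - q^N x. *)
Lemma pf_coef_rec (N : nat) (a q : C) (n : nat) : (Cmod q < 1)%R -> q <> 0 ->
  pf_coef (S N) a q (S n) - q ^ N * pf_coef (S N) a q n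
  = pf_coef N a q (S n) - a * q ^ N * pf_coef N a q n.
Proof.
  intros Hq Hq0. unfold pf_coef. apply conv_rec.
  - unfold qbin_coef. simpl. reflexivity.
  - intros k. unfold qbin_coef.
    pose proof (qpoch_neq_0_small q q (S k) Hq Hq) as Hk.
    rewrite (qpoch_S_l (/ q ^ S N)).
    replace (/ q ^ S N * q) with (/ q ^ N)
      by (simpl; field; split; [apply Cpow_nz|]; assumption).
    simpl in *. apply Cmult_neq_0_inv in Hk as [Hk1 Hk2].
    rewrite !Cpow_mult_l. pose proof (Cpow_nz q N Hq0).
    field. repeat split; assumption.
  - reflexivity.
  - intros m. unfold qbin_coef.
    pose proof (qpoch_neq_0_small q q (S m) Hq Hq) as Hk.
    rewrite (qpoch_S_l (q ^ N)). replace (q ^ N * q) with (q ^ S N) by (simpl; ring).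
    simpl in *. apply Cmult_neq_0_inv in Hk as [Hk1 Hk2].
    field. split; assumption.
Qed.

Lemma one_minus_pow_neq_0 (q : C) (N j : nat) :
  (Cmod q < 1)%R -> (j < N)%nat -> 1 - q ^ (N - j) <> 0.
Proof.
  intros Hq Hj. apply one_minus_neq_0.
  replace (N - j)%nat with (S (N - j - 1)) by lia.
  rewrite Cpow_S, Cmod_mult.
  pose proof (Cmod_pow_le_1 q (N - j - 1) (Rlt_le _ _ Hq)).
  pose proof (Cmod_ge_0 q). pose proof (Cmod_ge_0 (q ^ (N - j - 1))). nra.
Qed.

Lemma Cpow_sub (q : C) (N j : nat) : (j < N)%nat -> q ^ N = q ^ (N - j) * q ^ j.
Proof. intros H. rewrite <- Cpow_add_r. f_equal. lia. Qed.

(* The last clause reflects that beta_j is a nonzero multiple of (a q^(-j))_N.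
   In the induction step, beta' comes from splitting
   (1 - a q^N x)/((1 - q^j x)(1 - q^N x)) into partial fractions. *)
Lemma partial_fractions (a q : C) (N : nat) :
  (Cmod q < 1)%R -> q <> 0 ->
  exists beta : nat -> C,
    (forall n, pf_coef N a q (S n) = csum (fun j => beta j * (q ^ j) ^ S n) N) /\
    (forall x, (forall j, (j < N)%nat -> 1 - x * q ^ j <> 0) ->
       qpoch (a * x) q N
       = qpoch x q N * (1 + csum (fun j => beta j * (x * q ^ j / (1 - x * q ^ j))) N)) /\
    (forall j x, (j < N)%nat -> x * q ^ j = 1 -> beta j = 0 -> qpoch (a * x) q N = 0).
Proof.
  intros Hq Hq0. induction N as [|N [beta [HB [HF HZ]]]].
  - exists (fun _ => 0). repeat split.
    + intros n. now rewrite pf_coef_0_S.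
    + intros x _. simpl. ring.
    + intros j x Hj. lia.
  (* [d j] is the value of 1 - q^N x at the old pole x = q^(-j), and 1 - a q^(N-j) that of 1 - a q^N
     x. At the new pole x = q^(-N), the partial fractions of f_N = (ax)_N/(x)_N evaluate to 1 minus
     the sum of the beta_j/d_j, so [top] is (1 - a) f_N(q^(-N)). *)
  - set (d := fun j => 1 - q ^ (N - j)).
    assert (forall j, (j < N)%nat -> d j <> 0) as Hd
      by (intros; now apply one_minus_pow_neq_0).
    set (top := (1 - a) * (1 - csum (fun j => beta j / d j) N)).
    set (beta' := fun j => if Nat.ltb j N then beta j * (1 - a * q ^ (N - j)) / d j else top).
    assert (beta' N = top) as EN by (unfold beta'; now rewrite Nat.ltb_irrefl).
    assert (forall j, (j < N)%nat -> beta' j = beta j * (1 - a * q ^ (N - j)) / d j) as EL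
      by (intros j Hj; unfold beta'; now rewrite (proj2 (Nat.ltb_lt j N) Hj)).
    exists beta'. split; [|split].
    + induction n as [|n IH].
      (* The formula starts at index 1, so the base case uses the coefficient 1 at index 0
         instead. *)
      * pose proof (pf_coef_rec N a q O Hq Hq0) as E.
        rewrite !pf_coef_O, HB in E.
        transitivity (q ^ N - a * q ^ N + csum (fun j => beta j * (q ^ j) ^ 1) N).
        { replace (pf_coef (S N) a q 1)
            with (pf_coef (S N) a q 1 - q ^ N * 1 + q ^ N) by ring. rewrite E. ring. }
        cbn [csum]. rewrite EN. unfold top.
        rewrite (csum_ext (fun j => beta' j * (q ^ j) ^ 1)
                   (fun j => beta j * (q ^ j) ^ 1 + (1 - a) * q ^ N * (beta j / d j))).
        { rewrite csum_plus, csum_scal, Cpow_1_r. ring. }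
        intros j Hj. rewrite EL by exact Hj. specialize (Hd j Hj).
        rewrite (Cpow_sub q N j Hj). unfold d in *. rewrite !Cpow_1_r. field. exact Hd.
      * pose proof (pf_coef_rec N a q (S n) Hq Hq0) as E.
        rewrite !HB, IH in E.
        replace (pf_coef (S N) a q (S (S n)))
          with (pf_coef (S N) a q (S (S n))
                - q ^ N * csum (fun j => beta' j * (q ^ j) ^ S n) (S N)
                + q ^ N * csum (fun j => beta' j * (q ^ j) ^ S n) (S N)) by ring.
        rewrite E. simpl csum. rewrite EN.
        replace (csum (fun j => beta' j * (q ^ j * (q ^ j * (q ^ j) ^ n))) N)
          with (csum (fun j => beta j * (q ^ j * (q ^ j * (q ^ j) ^ n))) N
                + (- (a * q ^ N) * csum (fun j => beta j * (q ^ j * (q ^ j) ^ n)) N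
                   + q ^ N * csum (fun j => beta' j * (q ^ j * (q ^ j) ^ n)) N)); [ring|].
        rewrite <- !csum_scal, <- !csum_plus. apply csum_ext. intros j Hj.
        rewrite EL by exact Hj. specialize (Hd j Hj).
        rewrite (Cpow_sub q N j Hj). unfold d in *. field. exact Hd.
    + intros x Hx. simpl qpoch.
      rewrite HF by (intros j Hj; apply Hx; lia).
      pose proof (Hx N (Nat.lt_succ_diag_r N)) as HxN.
      simpl csum. rewrite EN. unfold top.
      rewrite (csum_ext (fun j => beta' j * (x * q ^ j / (1 - x * q ^ j)))
                 (fun j => (1 - a * x * q ^ N) / (1 - x * q ^ N)
                             * (beta j * (x * q ^ j / (1 - x * q ^ j)))
                           + (1 - a) * (x * q ^ N / (1 - x * q ^ N)) * (beta j / d j))).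
      * rewrite csum_plus, !csum_scal. field. exact HxN.
      * intros j Hj. rewrite EL by exact Hj. specialize (Hd j Hj).
        pose proof (Hx j (Nat.lt_lt_succ_r _ _ Hj)) as Hxj.
        rewrite (Cpow_sub q N j Hj) in *. unfold d in *. field. auto.
    + intros j x Hj Hxj Hb. simpl.
      destruct (Nat.eq_dec j N) as [->|NE].
      (* At the new pole, either a = 1 and the last factor 1 - a x q^N vanishes, or f_N(x) = 0 and
         already (ax)_N = 0. *)
      * rewrite EN in Hb. unfold top in Hb.
        destruct (Cmult_eq_0 _ _ Hb) as [Ha|Hs].
        -- replace (1 - a * x * q ^ N) with (1 - a * (x * q ^ N)) by ring.
           rewrite Hxj. replace (1 - a * 1) with (1 - a) by ring. rewrite Ha. ring.
        -- assert (forall i, (i < N)%nat -> x * q ^ i * q ^ (N - i) = 1) as Hi.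
           { intros i Hi. rewrite <- Hxj, (Cpow_sub q N i Hi). ring. }
           assert (forall i, (i < N)%nat -> 1 - x * q ^ i <> 0) as Hnz.
           { intros i Hin Heq. apply (Hd i Hin). unfold d.
             assert (x * q ^ i = 1) as Ex by (symmetry; now apply Cminus_eq_0).
             specialize (Hi i Hin). rewrite Ex in Hi.
             replace (q ^ (N - i)) with (1 * q ^ (N - i)) by ring. rewrite Hi. ring. }
           rewrite HF by exact Hnz.
           rewrite (csum_ext _ (fun i => - (1) * (beta i / d i))).
           ++ rewrite csum_scal.
              replace (1 + - (1) * csum (fun j => beta j / d j) N)
                with (1 - csum (fun j => beta j / d j) N) by ring.
              rewrite Hs. ring.
           ++ intros i Hin. specialize (Hd i Hin). specialize (Hnz i Hin).
              specialize (Hi i Hin).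
              assert (x * q ^ i / (1 - x * q ^ i) = - (1) / d i) as ->;
                [|unfold Cdiv; ring].
              assert (x * q ^ i * d i = x * q ^ i - 1) as Ed.
              { unfold d. transitivity (x * q ^ i - x * q ^ i * q ^ (N - i)); [ring|].
                now rewrite Hi. }
              transitivity (x * q ^ i * d i / (d i * (1 - x * q ^ i)));
                [field; split; assumption|].
              rewrite Ed. field. split; assumption.
      (* At an old pole, either [beta j] = 0 and the induction hypothesis applies, or a q^(N-j) = 1
         and, as x q^j = 1, the last factor vanishes. *)
      * assert (j < N)%nat as Hj' by lia.
        rewrite EL in Hb by exact Hj'. specialize (Hd j Hj').
        assert (beta j * (1 - a * q ^ (N - j)) = 0) as Hb'.
        { replace (beta j * (1 - a * q ^ (N - j)))
            with (beta j * (1 - a * q ^ (N - j)) / d j * d j) by (field; exact Hd).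
          rewrite Hb. ring. }
        destruct (Cmult_eq_0 _ _ Hb') as [H0|H0].
        -- rewrite (HZ j x Hj' Hxj H0). ring.
        -- rewrite (Cpow_sub q N j Hj').
           replace (1 - a * x * (q ^ (N - j) * q ^ j))
             with (1 - a * q ^ (N - j) * (x * q ^ j)) by ring.
           rewrite Hxj, Cmult_1_r, H0. ring.
Qed.

(** * The two series *)

(** All the q-shifted factorials and the inverses of the nonvanishing ones are bounded, so the
    left-hand series is dominated by a geometric one whatever the size of t. *)
Lemma lhs_term_bounded (N : nat) (a b c t q : C) :
  (Cmod q < 1)%R ->
  (forall n, qpoch (a * t) q n <> 0) -> (forall n, qpoch (t * q ^ N) q n <> 0) ->
  exists s : nat -> C,
    (exists M : R, forall n, (Cmod (s n) <= M)%R) /\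
    forall n, lhs_term N a b c t q n = s n * b ^ n.
Proof.
  intros Hq Hat HtqN.
  exists (fun n => qbin_coef (c / b) q n
                   * (qpoch t q n * / qpoch (a * t) q n
                      * (qpoch (a * t * q ^ N) q n * / qpoch (t * q ^ N) q n))).
  split.
  - repeat apply bounded_mult; try now apply qpoch_bounded.
    + apply qpoch_inv_bounded; [exact Hq|]. intros n. now apply qpoch_neq_0_small.
    + now apply qpoch_inv_bounded.
    + now apply qpoch_inv_bounded.
  - intros n. unfold lhs_term, qbin_coef, Cdiv. ring.
Qed.

Lemma rhs_term_split (N : nat) (a b c t q : C) (n : nat) : (Cmod q < 1)%R ->
  (forall k, qpoch c q k <> 0) ->
  rhs_term N a b c t q n = pf_coef N a q n * (qpoch b q n / qpoch c q n) * t ^ n.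
Proof.
  intros Hq Hc. rewrite <- rhs_coef_pf_coef by exact Hq. unfold rhs_term.
  field. split; [apply Hc | now apply qpoch_neq_0_small].
Qed.

Lemma Cdiv_neq_0 (x y : C) : x <> 0 -> y <> 0 -> x / y <> 0.
Proof.
  intros Hx Hy E. apply Hx. replace x with (x / y * y) by (field; exact Hy).
  rewrite E. ring.
Qed.

Lemma qpoch_ratio_clim (b c q : C) :
  (Cmod q < 1)%R -> (forall k, qpoch c q k <> 0) ->
  clim (fun n => qpoch b q n / qpoch c q n) (qpoch_inf b q / qpoch_inf c q).
Proof.
  intros Hq Hc. apply clim_mult; [now apply qpoch_clim_inf|].
  apply clim_inv; [now apply qpoch_clim_inf | now apply qpoch_inf_neq_0].
Qed.

Lemma bounded_csum (u : nat -> nat -> C) (N : nat) :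
  (forall j, (j < N)%nat -> exists M : R, forall n, (Cmod (u j n) <= M)%R) ->
  exists M : R, forall n, (Cmod (csum (fun j => u j n) N) <= M)%R.
Proof.
  induction N as [|N IH]; intros H.
  - exists 0%R. intros n. simpl. rewrite Cmod_0. lra.
  - destruct IH as [M HM]; [intros; apply H; lia|].
    destruct (H N) as [K HK]; [lia|].
    exists (M + K)%R. intros n. simpl.
    eapply Rle_trans; [apply Cmod_triangle|]. apply Rplus_le_compat; auto.
Qed.

(** Partial fractions make [pf_coef] a sum of N geometric sequences with ratios of modulus at most
    1, hence bounded. *)
Lemma ex_rhs_series (N : nat) (a b c t q : C) :
  (Cmod q < 1)%R -> q <> 0 -> (forall k, qpoch c q k <> 0) -> (Cmod t < 1)%R ->
  exists l, csers (rhs_term N a b c t q) l.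
Proof.
  intros Hq Hq0 Hc Ht.
  destruct (partial_fractions a q N Hq Hq0) as [beta [HB _]].
  assert (exists M : R, forall n,
            (Cmod (pf_coef N a q n * (qpoch b q n / qpoch c q n)) <= M)%R) as H.
  { apply bounded_mult; [|exact (clim_bounded _ _ (qpoch_ratio_clim b c q Hq Hc))].
    destruct (bounded_csum (fun j n => beta j * (q ^ j) ^ n) N) as [M HM].
    - intros j _. exists (Cmod (beta j)). intros n. rewrite Cmod_mult.
      pose proof (Cmod_pow_le_1 (q ^ j) n (Cmod_pow_le_1 q j (Rlt_le _ _ Hq))).
      pose proof (Cmod_ge_0 (beta j)). nra.
    - exists (Rmax 1 M). intros [|n].
      + rewrite pf_coef_O, Cmod_1. apply Rmax_l.
      + rewrite HB. eapply Rle_trans; [apply (HM (S n)) | apply Rmax_r]. }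
  destruct (csers_bounded_pow _ t Ht H) as [l Hl]. exists l.
  refine (csers_ext _ _ _ _ Hl). intros n. symmetry. now apply rhs_term_split.
Qed.

(** Since (b)_n/(c)_n has a nonzero limit, it can be divided out of the terms, so the sum of the
    beta_j (t q^j)^n tends to 0 and [csum_pow_clim_0] applies. *)
Lemma partial_fraction_coef_vanish (N : nat) (a b c t q l : C) (beta : nat -> C) :
  (Cmod b < 1)%R -> (Cmod q < 1)%R -> q <> 0 -> (forall k, qpoch c q k <> 0) ->
  (forall n, pf_coef N a q (S n) = csum (fun j => beta j * (q ^ j) ^ S n) N) ->
  csers (rhs_term N a b c t q) l ->
  forall j, (j < N)%nat -> (1 <= Cmod (t * q ^ j))%R -> beta j = 0.
Proof.
  intros Hb Hq Hq0 Hc HB Hl.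
  assert (forall k, qpoch b q k <> 0) as Hbn by (intros; now apply qpoch_neq_0_small).
  pose proof (qpoch_inf_neq_0 b q Hq Hbn) as Hbi.
  pose proof (qpoch_inf_neq_0 c q Hq Hc) as Hci.
  apply csum_pow_clim_0; [exact Hq | exact Hq0 |].
  apply (proj2 (clim_shift (fun n => csum (fun j => beta j * (t * q ^ j) ^ n) N) 0 1)).
  pose proof (clim_mult _ _ _ _ (csers_term_0 _ _ Hl)
                (clim_inv _ _ (qpoch_ratio_clim b c q Hq Hc)
                   (Cdiv_neq_0 _ _ Hbi Hci))) as H.
  rewrite Cmult_0_l in H.
  refine (clim_ext _ _ _ _ (proj1 (clim_shift _ _ 1) H)).
  intros n. rewrite Nat.add_1_r, rhs_term_split, HB by assumption.
  transitivity (t ^ S n * csum (fun j => beta j * (q ^ j) ^ S n) N).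
  - field. split; auto.
  - rewrite <- csum_scal. apply csum_ext. intros j _. rewrite Cpow_mult_l. ring.
Qed.

(** Both sums are computed as combinations of the same values [G j], with the weights beta_j of the
    partial fractions, and then compared. *)
Lemma csers_lhs_of_csers_rhs (N : nat) (a b c t q l : C) :
  (Cmod b < 1)%R -> (Cmod q < 1)%R -> b <> 0 -> q <> 0 ->
  (forall n, qpoch (a * t) q n <> 0) -> (forall n, qpoch (t * q ^ N) q n <> 0) ->
  (forall n, qpoch c q n <> 0) ->
  csers (rhs_term N a b c t q) l ->
  csers (lhs_term N a b c t q)
    (qpoch t q N * qpoch_inf c q / (qpoch (a * t) q N * qpoch_inf b q) * l).
Proof.
  intros Hb Hq Hb0 Hq0 Hat HtqN Hc Hl.
  assert (forall k, qpoch b q k <> 0) as Hbn by (intros; now apply qpoch_neq_0_small).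
  pose proof (qpoch_inf_neq_0 b q Hq Hbn) as Hbi.
  pose proof (qpoch_inf_neq_0 c q Hq Hc) as Hci.
  destruct (partial_fractions a q N Hq Hq0) as [beta [HB [HF HZ]]].
  pose proof (partial_fraction_coef_vanish N a b c t q l beta Hb Hq Hq0 Hc HB Hl) as HV.
  assert (forall k, 1 - t * q ^ k <> 0) as Ht.
  { intros k Ek. assert (t * q ^ k = 1) as Ek1 by (symmetry; now apply Cminus_eq_0).
    destruct (Nat.lt_ge_cases k N) as [Hk|Hk].
    - apply (Hat N), (HZ k t Hk Ek1), HV; [exact Hk|]. rewrite Ek1, Cmod_1. lra.
    - apply (qpoch_neq_0_factor (t * q ^ N) q (S (k - N)) (k - N) (HtqN _)); [lia|].
      rewrite <- Cmult_assoc, <- Cpow_add_r. now replace (N + (k - N))%nat with k by lia. }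
  set (g := fun m => qbin_coef (c / b) q m * b ^ m).
  (* The expansion at n = 0, which accounts for the constant part of f. *)
  assert (csers g (qpoch_inf c q / qpoch_inf b q)) as Hg.
  { pose proof (qpoch_ratio_expansion b c q O Hb Hq Hb0 Hc) as H. simpl in H.
    replace (1 / 1 * (qpoch_inf c q / qpoch_inf b q))
      with (qpoch_inf c q / qpoch_inf b q) in H by (field; exact Hbi).
    refine (csers_ext _ _ _ _ H). intros m. unfold g. rewrite Cpow_1_l. ring. }
  set (G := fun j => CSeries (fun m => g m / (1 - t * q ^ j * q ^ m))).
  (* This holds even if |t q^j| >= 1: the denominators tend to 1, so their inverses are bounded. *)
  assert (forall j, csers (fun m => g m / (1 - t * q ^ j * q ^ m)) (G j)) as HG.
  { intros j. apply csers_CSeries_ex.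
    destruct (csers_bounded_pow
                (fun m => qbin_coef (c / b) q m * / (1 - t * q ^ j * q ^ m)) b Hb) as [s Hs].
    - apply bounded_mult; [now apply qbin_coef_bounded|].
      apply (clim_bounded _ (/ (1 + - (t * q ^ j) * 0))). apply clim_inv.
      + refine (clim_ext _ _ _ _ (clim_plus _ _ _ _ (clim_const 1)
                  (clim_scal (- (t * q ^ j)) _ _ (clim_pow q Hq)))).
        intros m. ring.
      + replace (1 + - (t * q ^ j) * 0) with (RtoC 1) by ring. exact C1_nz.
    - exists s. refine (csers_ext _ _ _ _ Hs). intros m. unfold g, Cdiv. ring. }
  (* From u/(1 - u) = 1/(1 - u) - 1, f(x) is [rest] plus the sum of the beta_j/(1 - x q^j); [rest]
     contributes only to the term n = 0. *)
  set (rest := 1 - csum beta N).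
  assert (csers (rhs_term N a b c t q)
            (rest + csum (fun j => beta j * (qpoch_inf b q / qpoch_inf c q * G j)) N)) as HR.
  { pose proof (csers_first rest) as H0.
    assert (csers (fun n => csum (fun j => beta j * (qpoch b q n / qpoch c q n
                                                     * (t * q ^ j) ^ n)) N)
              (csum (fun j => beta j * (qpoch_inf b q / qpoch_inf c q * G j)) N)) as H1.
    { apply (csers_csum (fun j n => beta j * (qpoch b q n / qpoch c q n * (t * q ^ j) ^ n))
               (fun j => beta j * (qpoch_inf b q / qpoch_inf c q * G j))).
      intros j Hj. destruct (Rlt_le_dec (Cmod (t * q ^ j)) 1) as [Hy|Hy].
      - apply csers_scal. now apply qpoch_ratio_series.
      - rewrite (HV j Hj Hy), Cmult_0_l.
        refine (csers_ext _ _ _ _ csers_0). intros n. ring. }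
    refine (csers_ext _ _ _ _ (csers_plus _ _ _ _ H0 H1)).
    intros n. rewrite rhs_term_split by assumption. destruct n as [|n].
    - rewrite pf_coef_O. simpl.
      rewrite (csum_ext _ beta) by (intros; field). unfold rest. field.
    - rewrite HB.
      transitivity (qpoch b q (S n) / qpoch c q (S n) * t ^ S n
                    * csum (fun j => beta j * (q ^ j) ^ S n) N); [|ring].
      rewrite <- csum_scal, Cplus_0_l. apply csum_ext. intros j _.
      rewrite Cpow_mult_l. ring. }
  rewrite (clim_unique _ _ _ Hl HR).
  pose proof (csers_scal (qpoch t q N / qpoch (a * t) q N) _ _
                (csers_plus _ _ _ _ (csers_scal rest _ _ Hg)
                   (csers_csum (fun j m => beta j * (g m / (1 - t * q ^ j * q ^ m)))
                      (fun j => beta j * G j) N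
                      (fun j _ => csers_scal (beta j) _ _ (HG j))))) as HL.
  replace (qpoch t q N * qpoch_inf c q / (qpoch (a * t) q N * qpoch_inf b q)
           * (rest + csum (fun j => beta j * (qpoch_inf b q / qpoch_inf c q * G j)) N))
    with (qpoch t q N / qpoch (a * t) q N
          * (rest * (qpoch_inf c q / qpoch_inf b q) + csum (fun j => beta j * G j) N)).
  2: { rewrite (csum_ext (fun j => beta j * (qpoch_inf b q / qpoch_inf c q * G j))
                  (fun j => qpoch_inf b q / qpoch_inf c q * (beta j * G j))) by (intros; ring).
       rewrite csum_scal. field. repeat split; auto. }
  refine (csers_ext _ _ _ _ HL). intros m.
  assert (forall j, 1 - t * q ^ m * q ^ j <> 0) as Htm.
  { intros j. rewrite <- Cmult_assoc, <- Cpow_add_r. apply Ht. }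
  rewrite (csum_ext _ (fun j => g m * (beta j + beta j * (t * q ^ m * q ^ j / (1 - t * q ^ m * q ^ j))))).
  2: { intros j _. specialize (Htm j).
       replace (t * q ^ j * q ^ m) with (t * q ^ m * q ^ j) by ring. field. exact Htm. }
  rewrite csum_scal, csum_plus. unfold rest.
  (* The combined m-th term is g_m f(t q^m) up to the prefactor. *)
  transitivity (qpoch t q N / qpoch (a * t) q N * g m
                * (1 + csum (fun j => beta j * (t * q ^ m * q ^ j / (1 - t * q ^ m * q ^ j))) N));
    [ring|].
  pose proof (HF (t * q ^ m) (fun j _ => Htm j)) as EF.
  assert (qpoch (t * q ^ m) q N <> 0) as Hn by (apply qpoch_neq_0; intros; apply Htm).
  replace (1 + csum (fun j => beta j * (t * q ^ m * q ^ j / (1 - t * q ^ m * q ^ j))) N)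
    with (qpoch (a * (t * q ^ m)) q N / qpoch (t * q ^ m) q N) by (rewrite EF; field; exact Hn).
  (* Splitting (t)_(m+N) and (at)_(m+N) in both orders converts (a t q^m)_N/(t q^m)_N into the
     ratios of the left-hand term. *)
  pose proof (qpoch_add t q m N) as E1. pose proof (qpoch_add t q N m) as E2.
  rewrite (Nat.add_comm N m), E1 in E2.
  pose proof (qpoch_add (a * t) q m N) as E3. pose proof (qpoch_add (a * t) q N m) as E4.
  rewrite (Nat.add_comm N m), E3 in E4.
  unfold lhs_term, g, qbin_coef. rewrite (Cmult_assoc a t).
  assert (qpoch t q m = qpoch t q N * qpoch (t * q ^ N) q m / qpoch (t * q ^ m) q N) as ->
    by (rewrite <- E2; field; exact Hn).
  assert (qpoch (a * t * q ^ N) q m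
          = qpoch (a * t) q m * qpoch (a * t * q ^ m) q N / qpoch (a * t) q N) as ->.
  { transitivity (qpoch (a * t) q N * qpoch (a * t * q ^ N) q m / qpoch (a * t) q N).
    - field. apply Hat.
    - now rewrite <- E4. }
  field. repeat split; auto. now apply qpoch_neq_0_small.
Qed.

Theorem theorem1p2 (N : nat) (a b c t q : C)
    (HN : (0 < N)%nat)
    (Hb1 : (Cmod b < 1)%R)
    (Hq1 : (Cmod q < 1)%R)
    (* the expressions c/b and q^(-N) are defined *)
    (Hb0 : b <> 0)
    (Hq0 : q <> 0)
    (* no denominator vanishes *)
    (Hat : forall n : nat, qpoch (a * t) q n <> 0)
    (HtqN : forall n : nat, qpoch (t * q ^ N) q n <> 0)
    (Hc : forall n : nat, qpoch c q n <> 0) :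
  ex_Cseries (lhs_term N a b c t q) /\
  ((Cmod t < 1)%R -> ex_Cseries (rhs_term N a b c t q)) /\
  (* for |t| >= 1 the right-hand series diverges for generic a *)
  (ex_Cseries (rhs_term N a b c t q) ->
   CSeries (lhs_term N a b c t q)
   = qpoch t q N * qpoch_inf c q / (qpoch (a * t) q N * qpoch_inf b q)
     * CSeries (rhs_term N a b c t q)).
Proof.
  split; [|split].
  - destruct (lhs_term_bounded N a b c t q Hq1 Hat HtqN) as [s [Hs E]].
    destruct (csers_bounded_pow s b Hb1 Hs) as [l Hl].
    apply (ex_Cseries_csers _ l). refine (csers_ext _ _ _ _ Hl). intros n. now rewrite E.
  - intros Ht. destruct (ex_rhs_series N a b c t q Hq1 Hq0 Hc Ht) as [l Hl].
    exact (ex_Cseries_csers _ l Hl).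
  - intros [l Hl]. apply is_series_csers in Hl.
    rewrite (csers_CSeries _ l Hl). apply csers_CSeries.
    now apply csers_lhs_of_csers_rhs.
Qed.
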